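(* Let $(X,\mathcal{B}(X),\mu)$ be a $\sigma$-finite measure space and let $\mathbb{I}\subseteq\mathbb{R}$ be such that $\#\mathbb{I}\ge2$. Let $(P_t)_{t\in\mathbb{I}}$ be a family of projections, that is, linear operators $P_t:L^0(X)\to L^0(X)$ satisfying $$P_sP_t=P_{\min\{s,t\}}\qquad\text{for } s\neq t,\ s,t\in\mathbb{I}.$$ If the set $\mathbb{I}$ is uncountable, assume in addition that $\mathbb{I}\ni t\mapsto P_tf$ is continuous $\mu$-almost everywhere on $X$ for every $f\in L^0(X)$. Let $p,r\in(1,\infty)$ be fixed. Suppose that the operators $P_t$ are bounded on $L^p(X)$, and that the following two estimates hold: $$\sup_{J\in\mathbb{Z}_+}\sup_{I\in\mathfrak{S}_J(\mathbb{I})}\Bigl\|\Bigl(\sum_{j=0}^{J-1}|(P_{I_{j+1}}-P_{I_j})f|^r\Bigr)^{1/r}\Bigr\|_{L^p(X)}\lesssim_{p,r}\|f\|_{L^p(X)},\qquad f\in L^p(X),$$ and $$\Bigl\|\Bigl(\sum_{j\in\mathbb{Z}}\sup_{t\in\mathbb{I}}|P_tf_j|^r\Bigr)^{1/r}\Bigr\|_{L^p(X)}\lesssim_{p,r}\Bigl\|\Bigl(\sum_{j\in\mathbb{Z}}|f_j|^r\Bigr)^{1/r}\Bigr\|_{L^p(X)},\qquad (f_j)_{j\in\mathbb{Z}}\in L^p(X;\ell^r(\mathbb{Z})).$$ Then $$\sup_{J\in\mathbb{Z}_+}\sup_{I\in\mathfrak{S}_J(\mathbb{I})}\bigl\|O^r_{I,J}(P_tf:t\in\mathbb{I})\bigr\|_{L^p(X)}\lesssim_{p,r}\|f\|_{L^p(X)},\qquad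 f\in L^p(X).$$
   Context: $L^0(X)$ is the space of all $\mu$-measurable functions $f:X\to\mathbb{C}$. $A\lesssim_{p,r}B$ means $A\le CB$ with a constant $C>0$ depending on $p,r$ (but not on the functions $f$, $(f_j)$, nor on $J$, $I$). $\mathfrak{S}_J(\mathbb{I})$ is the set of strictly increasing sequences $I=(I_0<I_1<\cdots<I_J)$ of elements of $\mathbb{I}$; a supremum over the empty set is zero. For a family $(\mathfrak{a}_t:t\in\mathbb{I})$ of complex-valued measurable functions on $X$ and $1\le r<\infty$, $$O^r_{I,J}(\mathfrak{a}_t(x):t\in\mathbb{I}):=\Bigl(\sum_{j=0}^{J-1}\sup_{t\in\mathbb{I},\,I_j\le t<I_{j+1}}|\mathfrak{a}_t(x)-\mathfrak{a}_{I_j}(x)|^r\Bigr)^{1/r}.$$ *)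

(* Defs.v *)
From HB Require Import structures.
From mathcomp Require Import all_boot all_order all_algebra.
From mathcomp Require Import complex.
From mathcomp Require Import all_classical all_reals all_analysis.

Set Implicit Arguments.
Unset Strict Implicit.
Unset Printing Implicit Defensive.

Import Order.TTheory GRing.Theory Num.Theory.
Import numFieldNormedType.Exports.

Local Open Scope classical_set_scope.
Local Open Scope ring_scope.

(* The modulus of a complex number, as an element of R. *)
Definition modc (R : realType) (z : R[i]) : R := ComplexField.Normc.normc z.

(* Supremum of a set of nonnegative extended reals, equal to 0 on the empty
   set; [ereal_sup set0] would be -oo. *)
Definition esup0 (R : realType) (A : set (\bar R)) : \bar R :=
  ereal_sup (A `|` [set 0%E]).

Section function_spaces.
Context d (T : measurableType d) (R : realType).
Variable mu : {measure set T -> \bar R}.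
Implicit Types (p r : R) (f g : T -> R[i]).

Definition complex_measurable f : Prop :=
  measurable_fun [set: T] (fun x => complex.Re (f x)) /\
  measurable_fun [set: T] (fun x => complex.Im (f x)).

(* mu-measurable functions, i.e. those measurable for the completion of mu.
   Equality in L^0 is equality mu-almost everywhere; the functions themselves
   are kept because a supremum over an uncountable index set depends on the
   representatives. *)
Definition L0 : set (T -> R[i]) :=
  [set f | exists2 g, complex_measurable g & f = g %[ae mu]].

Definition Lnormc p f : \bar R := Lnorm mu p%:E (fun x => (modc (f x))%:E).

Definition Lp p : set (T -> R[i]) :=
  [set f | L0 f /\ (Lnormc p f < +oo)%E].

Definition lr_norm r (f : int -> T -> R[i]) (x : T) : \bar R :=
  ((\esum_(j in [set: int]) ((modc (f j x)) `^ r)%:E) `^ r^-1)%E.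

Definition Lp_lr p r : set (int -> T -> R[i]) :=
  [set f | (forall j, L0 (f j)) /\ (Lnorm mu p%:E (lr_norm r f) < +oo)%E].

(* The second clause says that Q is well defined on classes modulo equality
   almost everywhere. *)
Definition L0_linear_operator (Q : (T -> R[i]) -> (T -> R[i])) : Prop :=
  [/\ forall f, L0 f -> L0 (Q f),
      forall f g, L0 f -> L0 g -> f = g %[ae mu] -> Q f = Q g %[ae mu]
    & forall (a : R[i]) f g, L0 f -> L0 g ->
        Q (fun x => a * f x + g x) = (fun x => a * Q f x + Q g x) %[ae mu]].

Definition Lp_bounded p (Q : (T -> R[i]) -> (T -> R[i])) : Prop :=
  exists2 B : R, 0 < B &
    forall f, Lp p f -> (Lnormc p (Q f) <= B%:E * Lnormc p f)%E.

End function_spaces.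

(* Families indexed by a subset II of R are represented by total functions on
   R, of which only the values on II matter. *)
Definition projection_family d (T : measurableType d) (R : realType)
    (mu : {measure set T -> \bar R}) (II : set R)
    (P : R -> (T -> R[i]) -> (T -> R[i])) : Prop :=
  (forall t, II t -> L0_linear_operator mu (P t)) /\
  (forall s t, II s -> II t -> s != t -> forall f, L0 mu f ->
     P s (P t f) = P (Num.min s t) f %[ae mu]).

(* The topology on R[i] is that of its regular module R[i]^o. *)
Definition ae_continuous_family d (T : measurableType d) (R : realType)
    (mu : {measure set T -> \bar R}) (II : set R)
    (P : R -> (T -> R[i]) -> (T -> R[i])) : Prop :=
  forall f, L0 mu f ->
    {ae mu, forall x, {within II, continuous (fun t : R => P t f x : R[i]^o)}}.

(* Sequences I_0 < ... < I_J in II, as functions on nat of which only the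
   values at 0, ..., J matter. *)
Definition incr_seqs (R : realType) (II : set R) (J : nat) : set (nat -> R) :=
  [set I | (forall j, (j <= J)%N -> II (I j)) /\
           (forall j, (j < J)%N -> I j < I j.+1)].

Definition oscillation (R : realType) (T : Type) (r : R) (II : set R)
    (I : nat -> R) (J : nat) (a : R -> T -> R[i]) (x : T) : \bar R :=
  ((\sum_(j < J)
      ereal_sup [set (modc (a t x - a (I j) x)%R `^ r)%:E
                | t in [set t | II t /\ (I j <= t < I j.+1)%R]]) `^ r^-1)%E.

Definition jump_sum (R : realType) (T : Type) (r : R)
    (I : nat -> R) (J : nat) (a : R -> T -> R[i]) (x : T) : \bar R :=
  ((\sum_(j < J) (modc (a (I j.+1) x - a (I j) x)%R `^ r)%:E) `^ r^-1)%E.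

Definition maximal_lr (R : realType) (T : Type) (r : R) (II : set R)
    (P : R -> (T -> R[i]) -> (T -> R[i])) (f : int -> T -> R[i])
    (x : T) : \bar R :=
  ((\esum_(j in [set: int])
      ereal_sup [set (modc (P t (f j) x) `^ r)%:E | t in II]) `^ r^-1)%E.

(* Main.v *)
Require Import Defs.
From mathcomp Require Import all_boot all_order all_algebra.
From mathcomp Require Import complex.
From mathcomp Require Import all_classical all_reals all_analysis.
From mathcomp Require Import measurable_realfun.

(** Fix an increasing sequence [I] of length [J]. For
    [I j < t < I j.+1] the projection rule gives [P t (P (I j.+1) f) = P t f]
    and [P t (P (I j) f) = P (I j) f], so that
    [P t f - P (I j) f = P t (g j)] where [g j := P (I j.+1) f - P (I j) f].
    Hence the oscillation of [t |-> P t f] along [I] is dominated pointwise by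
    the maximal l^r function of the family [g] (at [t = I j] the difference is
    zero; [oscillation_le_maximal_lr]). The vector-valued maximal estimate
    bounds the norm of the latter by [C2] times the norm of the l^r norm of
    [g], which is exactly the jump sum of [f] along [I]
    ([lr_norm_increments]); the jump estimate bounds this by [C1] times the
    norm of [f]. The constant is therefore [C2 * C1].

    Two points need care. First, each identity
    [P t (g j) = P t f - P (I j) f] holds off a null set that depends on [t].
    One null set serves for all [t] in a countable set; for uncountable [II]
    one takes a countable dense subset of [II] between [I j] and [I j.+1], and
    almost everywhere continuity of [t |-> P t f] and [t |-> P t (g j)] extends
    the identity to all [t] ([projection_increment_uniform]). Secondly,
    suprema over an uncountable index set need not be measurable, so the norms
    are lower integrals, and almost everywhere monotonicity has to be
    established without measurability ([ae_le_Lnorm]). *)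

Import Order.TTheory GRing.Theory Num.Theory.
Import numFieldNormedType.Exports.
Import HBNNSimple.

Set Implicit Arguments.
Unset Strict Implicit.
Unset Printing Implicit Defensive.

Local Open Scope classical_set_scope.
Local Open Scope ring_scope.

(** * Almost everywhere monotonicity without measurability *)

(** The integral of a nonnegative function is the supremum of the integrals of
    the simple functions below it, measurable or not. Replacing such a simple
    function by zero on a null set outside of which [f <= g] puts it below
    [g] everywhere and does not change its integral. *)
Lemma ae_ge0_le_lower_integral (d : measure_display) (T : measurableType d)
    (R : realType) (mu : {measure set T -> \bar R}) (f g : T -> \bar R) :
  (forall x, 0 <= f x)%E -> (forall x, 0 <= g x)%E ->
  {ae mu, forall x, (f x <= g x)%E} ->
  (\int[mu]_x f x <= \int[mu]_x g x)%E.
Proof.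
move=> f0 g0 [N [mN muN0 Nfg]].
rewrite [leLHS]ge0_integralTE// [leRHS]ge0_integralTE//.
apply: ge_ereal_sup => _ [h hf <-]; apply: le_ereal_sup_tmp.
pose k := proj_nnsfun h (measurableC mN).
have kE x : k x = h x * \1_(~` N) x by rewrite /k /= /mindic.
exists (sintegral mu k).
  exists k => // x; rewrite kE indicE.
  case: (boolP (x \in ~` N)) => xN; last by rewrite mulr0 g0.
  rewrite mulr1; apply: le_trans (hf x) _; apply: contrapT => fg.
  by move: xN; rewrite inE; apply; apply: Nfg.
rewrite -!integralT_nnsfun; apply: ae_ge0_le_integral => //.
- by move=> x _; rewrite lee_fin.
- exact/measurable_EFinP.
- by move=> x _; rewrite lee_fin.
- exact/measurable_EFinP.
- exists N; split => // x hk; apply: contrapT => xN; apply: hk => _.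
  by rewrite kE indicE mem_set// mulr1.
Qed.

Lemma ae_le_Lnorm (d : measure_display) (T : measurableType d)
    (R : realType) (mu : {measure set T -> \bar R}) (p : R)
    (f g : T -> \bar R) : 0 <= p ->
  (forall x, 0 <= f x)%E -> {ae mu, forall x, (f x <= g x)%E} ->
  (Lnorm mu p%:E f <= Lnorm mu p%:E g)%E.
Proof.
move=> p0 f0 fg; rewrite unlock.
apply: gt0_ler_poweR; rewrite ?invr_ge0// ?in_itv/= ?leey ?andbT.
- by apply: integral_ge0 => x _; exact: poweR_ge0.
- by apply: integral_ge0 => x _; exact: poweR_ge0.
apply: ae_ge0_le_lower_integral => [x|x|]; rewrite ?poweR_ge0//.
near=> x; have fgx : (f x <= g x)%E by near: x.
apply: gt0_ler_poweR; rewrite ?in_itv/= ?leey ?andbT//.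
by rewrite !gee0_abs// (le_trans (f0 x)).
Unshelve. all: by end_near. Qed.

(** * Identities holding for all times off one null set *)

Lemma ae_forall_countable (d : measure_display) (T : measurableType d)
    (R : realType) (mu : {measure set T -> \bar R}) (I : Type) (D : set I)
    (Q : I -> T -> Prop) : countable D ->
  (forall i, D i -> {ae mu, forall x, Q i x}) ->
  {ae mu, forall x, forall i, D i -> Q i x}.
Proof.
move=> /countable_injP[g ginj] DQ.
pose F n := [set x | exists i, [/\ D i, g i = n & ~ Q i x]].
have: mu.-negligible (\bigcup_n F n).
  apply: negligible_bigcup => n.
  have [[i [Di gi]]|ni] := pselect (exists i, D i /\ g i = n).
    apply: negligibleS (DQ i Di) => x [j [Dj gj]].
    by rewrite (ginj j i) ?inE// gj gi.
  apply: negligibleS (negligible_set0 _) => x [i [Di gi _]].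
  by apply: ni; exists i.
apply: negligibleS => x /= /existsNP[i /not_implyP[Di nQ]].
by exists (g i) => //; exists i.
Qed.

(** Choosing a point of [A] in every rational interval that meets [A] yields a
    countable set meeting every neighbourhood of every point of [A]. *)
Lemma countable_dense_subset (R : realType) (A : set R) :
  exists D : set R, [/\ countable D, D `<=` A & A `<=` closure D].
Proof.
pose B (q : rat * rat) := A `&` `]ratr q.1, ratr q.2[.
pose D := [set xget 0 (B q) | q in [set q | B q !=set0]].
have DB q : B q !=set0 -> B q (xget 0 (B q)).
  by move=> [x Bx]; apply: (@xgetPex _ 0 (B q)); exists x.
exists D; split => //.
- exact/(sub_countable (card_image_le _ _))/countableP.
- by move=> _ [q /= /DB[Aq _] <-].
move=> t At U /nbhs_ballP[e /= e0 eU].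
have /rat_in_itvoo[q1] : t - e < t by rewrite ltrBlDr ltrDl.
have /rat_in_itvoo[q2] : t < t + e by rewrite ltrDl.
rewrite !in_itv/= => /andP[tq2 q2e] /andP[eq1 q1t].
have /DB BD : B (q1, q2) !=set0 by exists t; split; rewrite //= in_itv/= q1t.
exists (xget 0 (B (q1, q2))); split.
  by exists (q1, q2) => //; exists (xget 0 (B (q1, q2))).
apply: eU; case: BD => _ /=; rewrite in_itv/= => /andP[h1 h2].
rewrite /ball/= ltr_distlC; apply/andP; split; first exact: lt_trans eq1 h1.
exact: lt_trans h2 q2e.
Qed.

Lemma within_continuous_closure_eq (S : topologicalType) (V : topologicalType)
    (A D : set S) (g h : S -> V) (t : S) : hausdorff_space V ->
  {within A, continuous g} -> {within A, continuous h} ->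
  D `<=` A -> {in D, g =1 h} -> A t -> closure D t -> g t = h t.
Proof.
move=> hV /subspace_continuousP gA /subspace_continuousP hA DA gh At Dt.
apply: hV => U W gU hW.
have /Dt[s [Ds [gs hs]]] :
    nbhs t [set s | (A s -> U (g s)) /\ (A s -> W (h s))].
  by apply: filterI; [exact: gA|exact: hA].
exists (g s); split; first exact/gs/DA.
by rewrite gh ?inE//; exact/hs/DA.
Qed.

(** * Measurable functions and projections *)

Section L0_theory.
Context d (T : measurableType d) (R : realType).
Variable mu : {measure set T -> \bar R}.
Implicit Types (f g : T -> R[i]).

Lemma L0_cst0 : L0 mu (fun=> 0 : R[i]).
Proof.
by exists (fun=> 0); [split; exact: measurable_cst | exact: aeW].
Qed.

Lemma L0B f g : L0 mu f -> L0 mu g -> L0 mu (fun x => f x - g x).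
Proof.
move=> [f' [mRf mIf] ff'] [g' [mRg mIg] gg']; exists (fun x => f' x - g' x).
  split.
    rewrite (_ : (fun x => _) =
      (fun x => complex.Re (f' x)) \- (fun x => complex.Re (g' x))).
      exact: measurable_funB.
    by apply/funext => x /=; case: (f' x) (g' x) => [? ?] [].
  rewrite (_ : (fun x => _) =
    (fun x => complex.Im (f' x)) \- (fun x => complex.Im (g' x))).
    exact: measurable_funB.
  by apply/funext => x /=; case: (f' x) (g' x) => [? ?] [].
by near=> x => _; rewrite (near ff' x) ?(near gg' x).
Unshelve. all: by end_near. Qed.

Lemma L0_linear_operatorB (Q : (T -> R[i]) -> (T -> R[i])) f g :
  L0_linear_operator mu Q -> L0 mu f -> L0 mu g ->
  Q (fun x => f x - g x) = (fun x => Q f x - Q g x) %[ae mu].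
Proof.
move=> [_ _ Qlin] L0f L0g; have := Qlin (-1) g f L0g L0f.
rewrite (_ : (fun x => -1 * g x + f x) = (fun x => f x - g x)).
  by apply: filterS => x + _ => ->//; rewrite mulN1r addrC.
by apply/funext => x; rewrite mulN1r addrC.
Qed.
End L0_theory.

Section projections.
Context d (T : measurableType d) (R : realType).
Variables (mu : {measure set T -> \bar R}) (II : set R).
Variable P : R -> (T -> R[i]) -> (T -> R[i]).
Hypothesis projP : projection_family mu II P.

(** By linearity the left-hand side is [P t (P b f) - P t (P a f)]; the minima
    of [t, b] and of [t, a] are [t] and [a]. The inequalities are strict because
    the projection rule is only assumed for distinct times. *)
Lemma projection_increment (f : T -> R[i]) (a b t : R) :
  L0 mu f -> II a -> II b -> II t -> a < t -> t < b ->
  P t (fun x => P b f x - P a f x) = (fun x => P t f x - P a f x) %[ae mu].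
Proof.
move=> L0f IIa IIb IIt at_ tb; have [linP minP] := projP.
have L0P s : II s -> L0 mu (P s f) by move=> /linP[+ _ _]; exact.
have Pta : P t (P a f) = P a f %[ae mu].
  by have := minP _ _ IIt IIa (negbT (gt_eqF at_)) f L0f; rewrite min_r// ltW.
have Ptb : P t (P b f) = P t f %[ae mu].
  by have := minP _ _ IIt IIb (negbT (lt_eqF tb)) f L0f; rewrite min_l// ltW.
have PB := L0_linear_operatorB (linP _ IIt) (L0P _ IIb) (L0P _ IIa).
by near=> x => _; rewrite (near PB x)// (near Pta x)// (near Ptb x).
Unshelve. all: by end_near. Qed.

Hypothesis contP : ~ countable II -> ae_continuous_family mu II P.

(** Countably many exceptional null sets are merged into one, and continuity
    in [t] carries the identity from a dense set to its closure. The dense set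
    is taken in [II `&` `]a, b[], not in [II], because the identity fails in
    general for [t] outside the open interval. *)
Lemma projection_increment_uniform (f : T -> R[i]) (a b : R) :
  L0 mu f -> II a -> II b ->
  {ae mu, forall x, forall t, II t /\ a < t < b ->
    P t (fun x => P b f x - P a f x) x = P t f x - P a f x}.
Proof.
move=> L0f IIa IIb; pose A := II `&` `]a, b[; set g := (fun x => _ - _).
have AE (D : set R) : countable D -> D `<=` A ->
    {ae mu, forall x, forall t, D t -> P t g x = P t f x - P a f x}.
  move=> cD DA; apply: ae_forall_countable => // t /DA[IIt].
  rewrite /= in_itv/= => /andP[at_ tb].
  have := projection_increment L0f IIa IIb IIt at_ tb.
  by apply: filterS => x; exact.
have [cI|/contP contf] := pselect (countable II).
  have /AE : countable A.
    by apply: sub_countable cI; apply: subset_card_le => ? [].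
  move=> /(_ (@subset_refl _ _)); apply: filterS => x + t [IIt abt].
  by apply; split => //=; rewrite in_itv.
have [D [cD DA AD]] := countable_dense_subset A.
have L0P s : II s -> L0 mu (P s f) by move=> /(proj1 projP)[+ _ _]; exact.
have cf := contf f L0f.
have cg := contf g (L0B (L0P _ IIb) (L0P _ IIa)).
have Dfg := AE D cD DA.
apply: filterS3 cf cg Dfg => x cfx cgx Dx t [IIt abt].
have cfax : {within II, continuous
    (fun t => (P t f x : R[i]^o) - P a f x : R[i]^o)}.
  by move=> s; apply: cvgB; [exact: cfx|exact: cvg_cst].
apply: (within_continuous_closure_eq _ cgx cfax (D := D)) => //.
- by move=> s /DA[].
- by move=> s /[!inE] /Dx.
- by apply: AD; split; rewrite //= in_itv.
Qed.
End projections.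

(** * Pointwise comparison of oscillations, maximal functions and jumps *)

Section esup0.
Context (R : realType).
Implicit Types (A : set (\bar R)) (y : \bar R).

Lemma esup0_ub A y : A y -> (y <= esup0 A)%E.
Proof. by move=> Ay; apply: ereal_sup_ubound; left. Qed.

Lemma ge_esup0 A y : (0 <= y)%E -> (forall z, A z -> z <= y)%E ->
  (esup0 A <= y)%E.
Proof. by move=> y0 Ay; apply: ge_ereal_sup => z [/Ay|->]. Qed.
End esup0.

Lemma sum_ord_esum_int (R : realType) (J : nat) (b : int -> \bar R) :
  (forall j, 0 <= b j)%E ->
  (\sum_(j < J) b j = \esum_(j in Posz @` `I_J) b j)%E.
Proof.
move=> b0; rewrite esum_image; last by move=> m n _ _ [].
by rewrite esum_fset//= (fsbig_ord _ _ (fun n => b (Posz n))).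
Qed.

(** The increments along [I], extended by zero to all integer indices so as to
    be an admissible family for the vector-valued maximal estimate. *)
Definition increments (R : realType) (T : Type) (I : nat -> R) (J : nat)
    (a : R -> T -> R[i]) (j : int) : T -> R[i] :=
  if j is Posz n then
    if (n < J)%N then fun x => a (I n.+1) x - a (I n) x else fun=> 0
  else fun=> 0.

Section increments.
Context d (T : measurableType d) (R : realType).
Variables (r : R) (I : nat -> R) (J : nat) (a : R -> T -> R[i]).
Hypothesis r0 : 0 < r.

Lemma incrementsE (j : 'I_J) :
  increments I J a j = (fun x => a (I j.+1) x - a (I j) x).
Proof. by rewrite /increments ltn_ord. Qed.

(** The integer indices other than 0, ..., J - 1 contribute [0 `^ r], which
    vanishes since [r > 0]. *)
Lemma lr_norm_increments : lr_norm r (increments I J a) = jump_sum r I J a.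
Proof.
apply/funext => x; rewrite /lr_norm /jump_sum; congr (_ `^ _)%E.
rewrite -[LHS](_ : \esum_(j in Posz @` `I_J)
   (modc (increments I J a j x) `^ r)%:E = _)%E.
  rewrite -sum_ord_esum_int => [|j]; last by rewrite lee_fin powR_ge0.
  by apply: eq_bigr => j _; rewrite incrementsE.
rewrite esum_mkcond; apply: eq_esum => j _; case: ifPn => // jJ.
have -> : increments I J a j = fun=> 0.
  rewrite /increments; case: j jJ => // n /negP nJ; case: ifPn => // nJ'.
  by exfalso; apply: nJ; rewrite inE; exists n.
by rewrite /modc ComplexField.Normc.normc0 powR0// gt_eqF.
Qed.

Lemma oscillation_ge0 (II : set R) (x : T) :
  (0 <= oscillation r II I J a x)%E.
Proof. exact: poweR_ge0. Qed.

(** For [I j < t < I j.+1] the term [modc (a t x - a (I j) x) `^ r] is one of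
    those in the supremum defining the maximal function of the increments, and
    at [t = I j] it is zero. *)
Lemma oscillation_le_maximal_lr (II : set R)
    (P : R -> (T -> R[i]) -> (T -> R[i])) (x : T) :
  incr_seqs II J I ->
  (forall j t, (j < J)%N -> II t /\ I j < t < I j.+1 ->
     P t (increments I J a j) x = a t x - a (I j) x) ->
  (oscillation r II I J a x <= maximal_lr r II P (increments I J a) x)%E.
Proof.
move=> [III Ilt] incP.
pose o j := ereal_sup [set (modc (a t x - a (I j) x)%R `^ r)%:E
  | t in [set t | II t /\ (I j <= t < I j.+1)%R]].
pose b (j : int) := ereal_sup
  [set (modc (P t (increments I J a j) x) `^ r)%:E | t in II].
have o_le_b (j : 'I_J) : (o j <= b j)%E.
  apply: ge_ereal_sup => _ [t [IIt /andP[Ijt tIj]] <-].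
  have /predU1P[<-|{}Ijt] : (I j == t) || (I j < t) by rewrite -le_eqVlt.
    rewrite subrr /modc ComplexField.Normc.normc0 powR0 ?gt_eqF//.
    apply: le_ereal_sup_tmp; eexists; first by exists (I j); [exact/III/ltnW|].
    by rewrite lee_fin powR_ge0.
  apply: ereal_sup_ubound; exists t => //; rewrite incP//.
  by split => //; rewrite Ijt.
have b0 j : (0 <= b j)%E.
  apply: le_ereal_sup_tmp; eexists; first by exists (I 0%N); [exact: III|].
  by rewrite lee_fin powR_ge0.
have sum_le : (\sum_(j < J) o j <= \esum_(j in [set: int]) b j)%E.
  apply: (le_trans (lee_sum _ (fun j _ => o_le_b j))).
  rewrite sum_ord_esum_int// esum_mkcond; apply: le_esum => j _.
  by case: ifP.
have sum_ge0 : (0 <= \sum_(j < J) o j)%E.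
  apply: sume_ge0 => j _; apply: le_ereal_sup_tmp; eexists.
    by exists (I j) => //; split; [exact/III/ltnW|rewrite lexx Ilt].
  by rewrite lee_fin powR_ge0.
apply: gt0_ler_poweR; rewrite ?invr_ge0 ?(ltW r0)// in_itv/= leey andbT//.
exact: le_trans sum_le.
Qed.
End increments.

(** * The oscillation estimate *)

Theorem theorem3p1 (R : realType) (p r : R) (hp : 1 < p) (hr : 1 < r)
    (C1 C2 : R) (hC1 : 0 < C1) (hC2 : 0 < C2) :
  exists2 C : R, 0 < C &
  forall (d : measure_display) (T : measurableType d)
    (mu : {sigma_finite_measure set T -> \bar R})
    (II : set R) (P : R -> (T -> R[i]) -> (T -> R[i])),
  (`I_2 #<= II)%card ->
  projection_family mu II P ->
  (~ countable II -> ae_continuous_family mu II P) ->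
  (forall t, II t -> Lp_bounded mu p (P t)) ->
  (forall f, Lp mu p f ->
     (esup0 [set esup0 [set Lnorm mu p%:E (jump_sum r I J (fun t => P t f))
                       | I in incr_seqs II J]
            | J in [set J : nat | (0 < J)%N]]
      <= C1%:E * Lnormc mu p f)%E) ->
  (forall f : int -> T -> R[i], Lp_lr mu p r f ->
     (Lnorm mu p%:E (maximal_lr r II P f)
      <= C2%:E * Lnorm mu p%:E (lr_norm r f))%E) ->
  forall f, Lp mu p f ->
    (esup0 [set esup0 [set Lnorm mu p%:E
                             (oscillation r II I J (fun t => P t f))
                      | I in incr_seqs II J]
           | J in [set J : nat | (0 < J)%N]]
     <= C%:E * Lnormc mu p f)%E.
Proof.
have r0 : 0 < r by exact: lt_trans hr.
exists (C2 * C1); first exact: mulr_gt0.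
move=> d T mu II P _ projP contP _ jumpP maxP f [L0f fp].
have f_ge0 : (0 <= Lnormc mu p f)%E by exact: Lnorm_ge0.
have C0 : (0 <= (C2 * C1)%:E * Lnormc mu p f)%E.
  by rewrite mule_ge0// lee_fin ltW// mulr_gt0.
apply: ge_esup0 => // _ [J J0 <-]; apply: ge_esup0 => // _ [I IJ <-].
have [III Ilt] := IJ.
set a := fun t => P t f; pose g := increments I J a.
have L0P s : II s -> L0 mu (P s f) by move=> /(proj1 projP)[+ _ _]; exact.
have L0g j : L0 mu (g j).
  rewrite /g /increments; case: j => [n|n]; last exact: L0_cst0.
  case: ifPn => [nJ|_]; last exact: L0_cst0.
  by apply: L0B; apply: L0P; apply: III => //; exact: ltnW.
have jump : (Lnorm mu p%:E (lr_norm r g) <= C1%:E * Lnormc mu p f)%E.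
  apply: le_trans (jumpP f (conj L0f fp)); rewrite lr_norm_increments//.
  apply: (@le_trans _ _ (esup0 [set Lnorm mu p%:E (jump_sum r I J a)
    | I in incr_seqs II J])); first by apply: esup0_ub; exists I.
  by apply: esup0_ub; exists J.
have gLp : Lp_lr mu p r g.
  split => //; apply: le_lt_trans jump _.
  by rewrite lte_mul_pinfty// lee_fin ltW.
rewrite EFinM -muleA.
apply: (@le_trans _ _ (C2%:E * Lnorm mu p%:E (lr_norm r g))%E); last first.
  by rewrite lee_pmul2l.
apply: le_trans (maxP g gLp); apply: ae_le_Lnorm.
- exact/ltW/(lt_trans ltr01).
- by move=> x; exact: oscillation_ge0.
have : {ae mu, forall x, forall j, [set j | (j < J)%N] j ->
    forall t, II t /\ I j < t < I j.+1 -> P t (g j) x = a t x - a (I j) x}.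
  apply: ae_forall_countable => [|j /= jJ]; first exact: countableP.
  rewrite /g /increments jJ.
  apply: (projection_increment_uniform projP contP L0f) => //.
    exact/III/ltnW.
  exact: III.
apply: filterS => x inc; apply: oscillation_le_maximal_lr => // j t jJ.
exact: inc.
Qed.
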